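(* Let $n,k$ be positive integers, and let $m_1+\cdots+m_k=n$ and $m_1'+\cdots+m_k'=n$ be any two partitions of $n$ into $k$ positive integer parts. Then the graphs $FB(m_1,\ldots,m_k)$ and $FB(m_1',\ldots,m_k')$ are cospectral with respect to the normalized Laplacian. That is, the spectrum of the normalized Laplacian of $FB(m_1,\ldots,m_k)$ is completely determined by $n$ and $k$.
   Context: All graphs are finite, simple and undirected. For positive integers $m_1,\ldots,m_k$ with $m_1+\cdots+m_k=n$, the ''fuzzy ball'' graph $FB(m_1,\ldots,m_k)$ is the graph on the $n+k$ vertices $b_1,\ldots,b_n,v_1,\ldots,v_k$ in which the $b_i$ induce a complete graph, each $v_i$ is adjacent to exactly $m_i$ vertices from $b_1,\ldots,b_n$ and to no other vertices, and each $b_i$ is adjacent to exactly one of $v_1,\ldots,v_k$. (This determines the graph up to isomorphism.) The normalized Laplacian of a graph is $\mathcal{L}=D^{-1/2}(D-\mathrm{Adj})D^{-1/2}$, where $\mathrm{Adj}$ is the adjacency matrix and $D$ is the diagonal matrix of degrees. Two graphs are cospectral with respect to a matrix if the associated matrices have the same eigenvalues with the same multiplicities. *)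

(* Defs.v *)
From HB Require Import structures.
From mathcomp Require Import all_boot all_order all_algebra.
From mathcomp Require Import complex.

Set Implicit Arguments.
Unset Strict Implicit.
Unset Printing Implicit Defensive.

Import Order.TTheory GRing.Theory Num.Theory.
Local Open Scope ring_scope.

Record sgraph := SGraph {
  vertex :> finType;
  adj : rel vertex;
  adj_sym : symmetric adj;
  adj_irr : irreflexive adj
}.

Definition deg (G : sgraph) (x : G) : nat := #|[set y : G | adj x y]|.

(* Matrices of G are indexed by 'I_#|G|, through the enumeration of the
   vertices of G by enum_val. *)
Section GraphMatrices.
Variables (R : rcfType) (G : sgraph).

Definition adj_mx : 'M[R]_#|G| :=
  \matrix_(i, j) (adj (enum_val i) (enum_val j))%:R.

Definition deg_mx : 'M[R]_#|G| :=
  diag_mx (\row_i (deg (enum_val i))%:R).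

(* Since 0^-1 = 0, an isolated vertex contributes a zero diagonal entry. *)
Definition deg_mx_invsqrt : 'M[R]_#|G| :=
  diag_mx (\row_i (Num.sqrt (deg (enum_val i))%:R)^-1).

Definition normalized_laplacian : 'M[R]_#|G| :=
  deg_mx_invsqrt *m (deg_mx - adj_mx) *m deg_mx_invsqrt.

End GraphMatrices.

(* Algebraic multiplicity of z as an eigenvalue of A, z ranging over the
   algebraic closure R[i] of R; it is 0 iff z is not an eigenvalue. *)
Definition eigen_mult (R : rcfType) (p : nat) (A : 'M[R]_p) (z : R[i]) : nat :=
  mup z (char_poly (map_mx (real_complex R) A)).

Definition cospectral (R : rcfType) (p q : nat) (A : 'M[R]_p) (B : 'M[R]_q) :
  Prop := forall z : R[i], eigen_mult A z = eigen_mult B z.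

(* G is a copy of FB(m_1, ..., m_k), with n ball vertices; the first clause
   says that the b i and the v j are pairwise distinct and exhaust the
   vertices of G. *)
Definition fuzzy_ball (n k : nat) (m : 'I_k -> nat) (G : sgraph) : Prop :=
  exists (b : 'I_n -> G) (v : 'I_k -> G),
    [/\ bijective (fun x : 'I_n + 'I_k =>
                     match x with inl i => b i | inr j => v j end),
        forall i1 i2 : 'I_n, i1 != i2 -> adj (b i1) (b i2),
        forall j : 'I_k, #|[set i : 'I_n | adj (v j) (b i)]| = m j,
        forall j1 j2 : 'I_k, ~~ adj (v j1) (v j2)
      & forall i : 'I_n, #|[set j : 'I_k | adj (b i) (v j)]| = 1%N].

(* Main.v *)
(** Up to a permutation of the vertices the normalized Laplacian has the block
    form [[a I + b Q u u^T Q^T, s Q], [s Q^T, c I]], where Q is the n x k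
    matrix with entries 1 / sqrt m_j at the edges b_i v_j, u = (sqrt m_j)_j and
    Q u is the all-ones vector.  Its characteristic polynomial is computed by a
    Schur complement followed by two applications of the Weinstein-Aronszajn
    identity, and the partition enters only through Q^T Q = I and u^T u = n. *)
Require Import Defs.
From HB Require Import structures.
From mathcomp Require Import all_boot all_order all_algebra.
From mathcomp Require Import perm complex.

Set Implicit Arguments.
Unset Strict Implicit.
Unset Printing Implicit Defensive.

Import Order.TTheory GRing.Theory Num.Theory.
Local Open Scope ring_scope.

(** * Determinant identities free of division, and invariance under reindexing *)

Section Determinants.
Variable R : comNzRingType.

(** Weinstein-Aronszajn identity, valid even when [a] is not invertible: right multiplication makes
    [M] block triangular in two ways, and the two determinants are compared. *)
Lemma det_scalar_add_mulmx (p q : nat) (a : R)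
    (A : 'M[R]_(p, q)) (B : 'M[R]_(q, p)) :
  \det (a%:M + A *m B) * a ^+ q = a ^+ p * \det (a%:M + B *m A).
Proof.
pose M := block_mx (a%:M : 'M_p) (- A) B (1%:M : 'M_q).
have detM : \det M = \det (a%:M + A *m B).
  have := det_mulmx M (block_mx 1%:M 0 (- B) 1%:M).
  rewrite mulmx_block !mulmx1 !mulmx0 !mul1mx mulNmx mulmxN opprK !add0r subrr.
  by rewrite det_ublock det_lblock !det1 !mulr1.
have := det_mulmx M (block_mx 1%:M A 0 a%:M).
rewrite mulmx_block !mulmx1 !mulmx0 !mul1mx !addr0 mul_scalar_mx mul_mx_scalar.
rewrite scalerN subrr det_lblock det_ublock det1 !det_scalar mul1r detM => <-.
by rewrite addrC.
Qed.

Lemma det_block_scalar_dr (p q : nat) (y : R) (A : 'M[R]_p)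
    (B : 'M[R]_(p, q)) (C : 'M[R]_(q, p)) :
  \det (block_mx A B C y%:M) * y ^+ p = y ^+ q * \det (y *: A - B *m C).
Proof.
have := det_mulmx (block_mx A B C y%:M) (block_mx y%:M 0 (- C) 1%:M).
rewrite mulmx_block !mulmx1 !mulmx0 !add0r !mul_mx_scalar mul_scalar_mx.
rewrite scalerN subrr mulmxN det_ublock det_lblock det1 !det_scalar mulr1 => <-.
by rewrite mulrC.
Qed.

End Determinants.

Lemma char_poly_mxsub (R : comNzRingType) (p q : nat) (f : 'I_p -> 'I_q)
    (A : 'M[R]_q) : bijective f -> char_poly (mxsub f f A) = char_poly A.
Proof.
move=> f_bij; have := bij_eq_card f_bij; rewrite !card_ord => epq.
(* Identifying [q] with [p] turns [f] into a permutation; it acts on rows and columns alike, so its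
   sign occurs squared. *)
case: q / epq f A f_bij => f A f_bij.
pose s := perm (bij_inj f_bij).
have -> : char_poly (mxsub f f A) = \det (row_perm s (col_perm s (char_poly_mx A))).
  congr (\det _); apply/matrixP=> i j.
  by rewrite !mxE !permE (inj_eq (bij_inj f_bij)).
rewrite row_permE col_permE !det_mulmx !det_perm odd_permV /char_poly mulrC -mulrA.
by rewrite -expr2 sqrr_sign mulr1.
Qed.

(** * Characteristic polynomial of the block matrix with a rank-one term *)

Section BlockCharPoly.
Variables (R : idomainType) (n k : nat) (a b c d s t : R).

(* The two sides are cross-multiplied by monic polynomials so that no division
   occurs. *)
Lemma char_poly_block_rank1 (Q : 'M[R]_(n, k)) (P : 'M[R]_(k, n))
    (u : 'cV[R]_k) (w : 'rV[R]_k) :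
  P *m Q = 1%:M -> w *m u = d%:M ->
  let y := 'X - c%:P in
  let e := y * ('X - a%:P) in
  let g := e - (s * t)%:P in
  char_poly (block_mx (a%:M + b *: (Q *m u *m (w *m P))) (s *: Q) (t *: P) c%:M)
    * (y ^+ n * e ^+ k * g)
  = y ^+ k * e ^+ n * g ^+ k * (g - y * (b * d)%:P).
Proof.
move=> PQ wu y e g.
pose Qp := map_mx polyC Q; pose Pp := map_mx polyC P.
pose up := map_mx polyC u; pose wp := map_mx polyC w.
have PQp : Pp *m Qp = 1%:M by rewrite -map_mxM PQ map_mx1.
have wup : wp *m up = (d%:P)%:M by rewrite -map_mxM wu map_scalar_mx.
rewrite /char_poly /char_poly_mx map_block_mx (@scalar_mx_block _ n k).
rewrite opp_block_mx add_block_mx !add0r !map_mxD !map_mxZ !map_scalar_mx.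
rewrite !map_mxM -/Qp -/Pp -/up -/wp.
have -> : 'X%:M - (polyC c)%:M = y%:M :> 'M_k by rewrite raddfB.
rewrite mulrA mulrA det_block_scalar_dr.
(* Both the rank-one term and the Schur correction factor through [Qp] on the left and [Pp] on the
   right. *)
have -> : y *: ('X%:M - ((polyC a)%:M + b%:P *: (Qp *m up *m (wp *m Pp))))
     - - (s%:P *: Qp) *m - (t%:P *: Pp)
   = e%:M + Qp *m ((- (s * t)%:P)%:M + (- (y * b%:P) *: up) *m wp) *m Pp.
  rewrite opprD addrA -raddfB scalerDr scale_scalar_mx -/e -addrA.
  congr (_ + _).
  rewrite mulmxDr mulmxDl addrC; congr (_ + _).
    rewrite mulNmx mulmxN opprK -scalemxAl -scalemxAr scalerA -polyCM.
    by rewrite mul_mx_scalar -scalemxAl scaleNr.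
  by rewrite scalerN scalerA -scalemxAl -scalemxAr -scalemxAl scaleNr !mulmxA.
(* Moving [Qp] to the right cancels it against [Pp] and leaves a determinant of size [k]; [g ^+ 1]
   prepares the second use of the identity, whose inner dimension is 1. *)
have -> : y ^+ k * \det (e%:M + Qp *m ((- (s * t)%:P)%:M
     + (- (y * b%:P) *: up) *m wp) *m Pp) * e ^+ k * g
   = y ^+ k * e ^+ n * (\det (g%:M + (- (y * b%:P) *: up) *m wp) * g ^+ 1).
  rewrite -(mulrA (y ^+ k)) -mulmxA mulmxA -[in LHS]mulmxA.
  rewrite det_scalar_add_mulmx -mulmxA PQp mulmx1 addrA -raddfD.
  by rewrite expr1 !mulrA.
rewrite det_scalar_add_mulmx -scalemxAr wup scale_scalar_mx -raddfD.
by rewrite mulNr -(mulrA y) -polyCM det_scalar expr1 !mulrA.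
Qed.

(** The matrices enter the cross-multiplied formula only through the scalar parameters, and the
    common factor is a nonzero polynomial over an integral domain. *)
Lemma char_poly_block_rank1_eq (Q Q' : 'M[R]_(n, k)) (P P' : 'M[R]_(k, n))
    (u u' : 'cV[R]_k) (w w' : 'rV[R]_k) :
  P *m Q = 1%:M -> w *m u = d%:M -> P' *m Q' = 1%:M -> w' *m u' = d%:M ->
  char_poly (block_mx (a%:M + b *: (Q *m u *m (w *m P))) (s *: Q) (t *: P) c%:M)
  = char_poly
      (block_mx (a%:M + b *: (Q' *m u' *m (w' *m P'))) (s *: Q') (t *: P') c%:M).
Proof.
move=> PQ wu PQ' wu'.
have y0 : 'X - c%:P != 0 by rewrite polyXsubC_eq0.
have e0 : ('X - c%:P) * ('X - a%:P) != 0 by rewrite mulf_neq0 ?polyXsubC_eq0.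
(* A constant cannot cancel a polynomial of degree 2. *)
have g0 : ('X - c%:P) * ('X - a%:P) - (s * t)%:P != 0.
  rewrite -size_poly_gt0 size_polyDl.
    by rewrite size_poly_gt0.
  rewrite size_polyN size_mul ?polyXsubC_eq0 // !size_XsubC.
  exact: leq_ltn_trans (size_polyC_leq1 _) _.
have r0 := mulf_neq0 (mulf_neq0 (expf_neq0 n y0) (expf_neq0 k e0)) g0.
by apply: (mulIf r0); rewrite !char_poly_block_rank1.
Qed.

End BlockCharPoly.

(** * Degrees, weighted incidence matrix and Laplacian of a fuzzy ball *)

Section FuzzyBall.
Variables (R : rcfType) (n k : nat) (m : 'I_k -> nat) (G : sgraph).
Variables (b : 'I_n -> G) (v : 'I_k -> G).
Hypothesis m_gt0 : forall j, (0 < m j)%N.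
Hypothesis bv_bij : bijective (fun x : 'I_n + 'I_k =>
  match x with inl i => b i | inr j => v j end).
Hypothesis adj_bb : forall i1 i2 : 'I_n, i1 != i2 -> adj (b i1) (b i2).
Hypothesis card_vb : forall j : 'I_k, #|[set i : 'I_n | adj (v j) (b i)]| = m j.
Hypothesis adj_vv : forall j1 j2 : 'I_k, ~~ adj (v j1) (v j2).
Hypothesis card_bv : forall i : 'I_n, #|[set j : 'I_k | adj (b i) (v j)]| = 1%N.

Lemma deg_split (x : G) :
  deg x = (#|[set i | adj x (b i)]| + #|[set j | adj x (v j)]|)%N.
Proof.
rewrite /deg -!sum1dep_card (reindex _ (onW_bij _ bv_bij)) /=.
by rewrite big_mkcond big_sumType /= -!big_mkcond.
Qed.

Lemma adj_bb_neq (i1 i2 : 'I_n) : adj (b i1) (b i2) = (i1 != i2).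
Proof. by case: eqVneq => [->|/adj_bb//]; apply: adj_irr. Qed.

Lemma deg_b (i : 'I_n) : deg (b i) = n.
Proof.
rewrite deg_split card_bv addn1.
rewrite (_ : [set _ | _] = [set~ i]).
  by rewrite cardsC1 card_ord prednK // (leq_ltn_trans _ (ltn_ord i)).
by apply/setP=> i2; rewrite !inE adj_bb_neq eq_sym.
Qed.

Lemma deg_v (j : 'I_k) : deg (v j) = m j.
Proof.
rewrite deg_split card_vb (_ : [set j1 | _] = set0) ?cards0 ?addn0 //.
by apply/setP=> j1; rewrite !inE (negbTE (adj_vv _ _)).
Qed.

Definition fb_incidence : 'M[R]_(n, k) :=
  \matrix_(i, j) ((adj (b i) (v j))%:R / Num.sqrt (m j)%:R).

Definition fb_weight : 'cV[R]_k := \col_j Num.sqrt (m j)%:R.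

Lemma sqrt_m_neq0 (j : 'I_k) : Num.sqrt (m j)%:R != 0 :> R.
Proof. by rewrite sqrtr_eq0 -ltNge ltr0n. Qed.

Lemma sqr_sqrt_nat (p : nat) : Num.sqrt p%:R ^+ 2 = p%:R :> R.
Proof. by rewrite sqr_sqrtr ?ler0n. Qed.

(** Column [j] has [m j] nonzero entries, each with square [1 / m j]; distinct columns have disjoint
    supports because each [b i] has a single neighbour among the [v j]. *)
Lemma fb_incidence_orthonormal : fb_incidence^T *m fb_incidence = 1%:M.
Proof.
apply/matrixP=> j1 j2; rewrite !mxE.
under eq_bigr do rewrite !mxE mulrACA.
rewrite -mulr_suml; case: eqVneq => [<-|neq_j].
  under eq_bigr do rewrite -natrM mulnb andbb adj_sym.
  rewrite -natr_sum -invfM -expr2 sqr_sqrt_nat.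
  have -> : (\sum_(i < n) adj (v j1) (b i))%N = m j1.
    by rewrite -card_vb -sum1dep_card [RHS]big_mkcond; apply: eq_bigr => i _; case: adj.
  by rewrite divff // pnatr_eq0 -lt0n.
rewrite big1 ?mul0r // => i _; rewrite -natrM mulnb.
have /cards1P[j0 /setP Ej0] : #|[set j : 'I_k | adj (b i) (v j)]| == 1%N.
  by rewrite card_bv.
have := Ej0 j1; have := Ej0 j2; rewrite !inE => -> ->.
by case: eqP => // <-; rewrite eq_sym (negbTE neq_j).
Qed.

(** The weights cancel, so row [i] counts the neighbours of [b i] among the [v j]. This lets the
    all-ones block factor through [fb_incidence]. *)
Lemma fb_incidence_weight : fb_incidence *m fb_weight = const_mx 1.
Proof.
apply/matrixP=> i j; rewrite !mxE.
under eq_bigr do rewrite !mxE divfK ?sqrt_m_neq0 //.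
rewrite -natr_sum -[1 in RHS]/(1%:R) -(card_bv i) -sum1dep_card [in RHS]big_mkcond.
by congr (_%:R); apply: eq_bigr => j1 _; case: adj.
Qed.

Lemma fb_weight_norm :
  fb_weight^T *m fb_weight = ((\sum_(j < k) m j)%N%:R)%:M.
Proof.
apply/matrixP=> i j; rewrite !mxE !ord1 eqxx mulr1n natr_sum.
by apply: eq_bigr => j1 _; rewrite !mxE -expr2 sqr_sqrt_nat.
Qed.

(** Reorders the vertices with the ball first, so that the Laplacian appears in blocks. *)
Definition fb_rank (i : 'I_(n + k)) : 'I_#|G| :=
  enum_rank (match split i with inl i1 => b i1 | inr j => v j end).

Lemma fb_rank_bij : bijective fb_rank.
Proof.
apply: (bij_comp (@enum_rank_bij G)); apply: (bij_comp bv_bij).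
by exists (@unsplit n k); [apply: splitK | apply: unsplitK].
Qed.

Lemma normalized_laplacianE (i j : 'I_#|G|) :
  normalized_laplacian R G i j =
  (Num.sqrt (deg (enum_val i))%:R)^-1 *
  ((deg (enum_val i))%:R *+ (i == j) - (adj (enum_val i) (enum_val j))%:R) /
  Num.sqrt (deg (enum_val j))%:R.
Proof.
by rewrite /normalized_laplacian mul_mx_diag mul_diag_mx !mxE.
Qed.

(** All ball vertices have degree [n], so with J the all-ones matrix their block is I - (J - I)/n =
    (1 + 1/n) I - J/n. An edge from [b i] to [v j] contributes -1/sqrt(n m_j), and the [v j] are
    pairwise non-adjacent. *)
Lemma mxsub_normalized_laplacian :
  mxsub fb_rank fb_rank (normalized_laplacian R G) =
  block_mx
    ((1 + n%:R^-1)%:M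
       + - n%:R^-1 *: (fb_incidence *m fb_weight
                         *m (fb_weight^T *m fb_incidence^T)))
    (- (Num.sqrt n%:R)^-1 *: fb_incidence)
    (- (Num.sqrt n%:R)^-1 *: fb_incidence^T) 1%:M.
Proof.
rewrite -trmx_mul fb_incidence_weight.
have sqrt_n_inv : (Num.sqrt n%:R)^-1 * (Num.sqrt n%:R)^-1 = n%:R^-1 :> R.
  by rewrite -invfM -expr2 sqr_sqrt_nat.
apply/matrixP=> i j; rewrite mxE normalized_laplacianE !enum_rankK.
(* Comparing indices through [split] settles the diagonal test in each of the four blocks. *)
rewrite (inj_eq (bij_inj fb_rank_bij)) -(inj_eq (can_inj (@splitK n k))) !mxE.
case: (split i) => i1; rewrite !mxE; case: (split j) => j1; rewrite !mxE ?deg_b ?deg_v.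
- rewrite -[inl i1 == inl j1]/(i1 == j1) adj_bb_neq mulrAC sqrt_n_inv.
  rewrite big_ord1 !mxE !mulr1.
  have n_neq0 : n%:R != 0 :> R.
    by rewrite pnatr_eq0 -lt0n (leq_ltn_trans _ (ltn_ord i1)).
  case: (i1 == j1) => /=; first by rewrite subr0 mulVf // addrK.
  by rewrite !mulr0n add0r sub0r mulrN mulr1.
- by rewrite mulr0n sub0r mulrN !mulNr mulrA.
- by rewrite mulr0n sub0r mulrN !mulNr adj_sym mulrC (mulrC _^-1 _%:R).
rewrite -[inr i1 == inr j1]/(i1 == j1) (negbTE (adj_vv _ _)) subr0.
case: eqVneq => [<-|_]; last by rewrite !mulr0n mulr0 mul0r.
by rewrite mulrAC -invfM -expr2 sqr_sqrt_nat mulVf // pnatr_eq0 -lt0n.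
Qed.

End FuzzyBall.

(** The two block forms share all their scalars, which depend on [n] alone; the squared norm of the
    weight vector is the sum of the parts, equal on both sides. *)
Lemma fuzzy_ball_char_poly (R : rcfType) (n k : nat) (m m' : 'I_k -> nat)
    (G G' : sgraph) :
  (forall j, 0 < m j)%N -> (forall j, 0 < m' j)%N ->
  (\sum_(j < k) m j)%N = (\sum_(j < k) m' j)%N ->
  fuzzy_ball n m G -> fuzzy_ball n m' G' ->
  char_poly (normalized_laplacian R G) = char_poly (normalized_laplacian R G').
Proof.
move=> m0 m0' sum_m [b [v [bv bb vb vv card_bv]]] [b' [v' [bv' bb' vb' vv' card_bv']]].
rewrite -(char_poly_mxsub _ (fb_rank_bij bv)) -(char_poly_mxsub _ (fb_rank_bij bv')).
rewrite (mxsub_normalized_laplacian R m0 bv bb vb vv card_bv).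
rewrite (mxsub_normalized_laplacian R m0' bv' bb' vb' vv' card_bv').
apply: char_poly_block_rank1_eq.
- exact: fb_incidence_orthonormal.
- exact: fb_weight_norm.
- exact: fb_incidence_orthonormal.
- by rewrite sum_m; apply: fb_weight_norm.
Qed.

Theorem mainTheorem6 (R : rcfType) (n k : nat) (hn : (0 < n)%N) (hk : (0 < k)%N)
  (m m' : 'I_k -> nat)
  (hm : forall j : 'I_k, (0 < m j)%N) (hm' : forall j : 'I_k, (0 < m' j)%N)
  (hsum : (\sum_(j < k) m j)%N = n) (hsum' : (\sum_(j < k) m' j)%N = n)
  (G G' : sgraph) (hG : fuzzy_ball n m G) (hG' : fuzzy_ball n m' G') :
  cospectral (normalized_laplacian R G) (normalized_laplacian R G').
Proof.
(* The characteristic polynomial over [R[i]] is the image of the one over [R], so equality over [R]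
   suffices. *)
move=> z; rewrite /eigen_mult -!map_char_poly; congr (mup z (map_poly _ _)).
by apply: (fuzzy_ball_char_poly R hm hm' _ hG hG'); rewrite hsum.
Qed.
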